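(* Every single-coalition-first neighborhood model $z$-represents a single-coalition-first action model; that is, for every single-coalition-first neighborhood model $N$ there is a single-coalition-first action model $M$ that is $z$-representable by $N$.
   Context: $AG$ is a finite nonempty set of agents, $AP$ a countable set of atomic propositions. For a nonempty set $AC$ and $C\subseteq AG$, $JA_C$ is the set of functions $\sigma_C:C\to AC$ ($JA_\emptyset=\{\emptyset\}$); $\sigma_C|_{\{a\}}$ is the restriction to $\{a\}$. A single-coalition-first action model is $M=(ST,AC,suc,\{out_a\}_{a\in AG},L)$ with $ST,AC$ nonempty, $suc:ST\to\mathcal P(ST)$, $out_a:ST\times JA_{\{a\}}\to\mathcal P(ST)$ with $\bigcup\{out_a(s,\sigma_a)\mid\sigma_a\in JA_{\{a\}}\}=suc(s)$ for all $s$, and $L:ST\to\mathcal P(AP)$. It determines $out_\emptyset(s,\emptyset)=suc(s)$, $out_C(s,\sigma_C)=\bigcap\{out_a(s,\sigma_C|_{\{a\}})\mid a\in C\}$ for nonempty $C$, $av_C(s)=\{\sigma_C\mid out_C(s,\sigma_C)\neq\emptyset\}$, and $AE_C(s)=\{out_C(s,\sigma_C)\mid\sigma_C\in av_C(s)\}$. A single-coalition-first neighborhood model is $N=(ST,suc,\{nei_a\}_{a\in AG},L)$ with $ST$ nonempty, $suc:ST\to\mathcal P(ST)$, $L:ST\to\mathcal P(AP)$, and for all $a,s$, $nei_a(s)\subseteq\mathcal P(ST)$ a cover of $suc(s)$ (union is $suc(s)$, $\emptyset\notin nei_a(s)$). With $\Delta_1\odot\Delta_2=\{Y_1\cap Y_2\mid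 Y_i\in\Delta_i,Y_1\cap Y_2\neq\emptyset\}$ (extended to finitely many families, $\bigodot\{\Delta\}=\Delta$): $nei_C(s)=\emptyset$ if $suc(s)=\emptyset$; $\{suc(s)\}$ if $suc(s)\neq\emptyset$, $C=\emptyset$; $\bigodot\{nei_a(s)\mid a\in C\}$ otherwise. $M$ is $z$-representable by $N$ (equivalently $N$ $z$-represents $M$) if they share $ST$ and $L$ and $AE_C=nei_C$ for all $C\subseteq AG$. *)

(* Defs.v *)
From mathcomp Require Import all_boot.
From mathcomp Require Import boolp classical_sets.

Set Implicit Arguments.
Unset Strict Implicit.
Unset Printing Implicit Defensive.

Local Open Scope classical_set_scope.

Definition joint_action (AG : finType) (AC : Type) (C : {set AG}) : Type :=
  {a : AG | a \in C} -> AC.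

Definition restrict (AG : finType) (AC : Type) (C D : {set AG})
    (DC : D \subset C) (sigma : joint_action AC C) : joint_action AC D :=
  fun x => sigma (exist _ (sval x) (fintype.subsetP DC (sval x) (svalP x))).

Definition restrict1 (AG : finType) (AC : Type) (C : {set AG})
    (a : {a : AG | a \in C}) (sigma : joint_action AC C) :
    joint_action AC [set sval a]%SET :=
  restrict (etrans (finset.sub1set C (sval a)) (svalP a)) sigma.
Arguments restrict1 {AG AC C} a sigma.

(* The carrier [ST] is a parameter, so that two models sharing their set of
   states are terms over the same type. *)
Record action_model (AG : finType) (AP : countType) (ST : Type) :=
  ActionModel {
    am_ST_nonempty : inhabited ST;
    am_AC : Type;
    am_AC_nonempty : inhabited am_AC;
    am_suc : ST -> set ST;
    am_out1 : forall a : AG, ST -> joint_action am_AC [set a]%SET -> set ST;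
    am_L : ST -> set AP;
    am_out1_suc : forall (a : AG) (s : ST),
      \bigcup_(sigma in [set: joint_action am_AC [set a]%SET])
        am_out1 s sigma = am_suc s }.

Section ActionModelTheory.
Variables (AG : finType) (AP : countType) (ST : Type).
Variable M : action_model AG AP ST.

Definition am_out (C : {set AG}) (s : ST) (sigma : joint_action (am_AC M) C) :
    set ST :=
  if C == finset.set0 then am_suc M s
  else \bigcap_(a in [set: {a : AG | a \in C}])
         am_out1 s (restrict1 a sigma).

Definition am_av (C : {set AG}) (s : ST) : set (joint_action (am_AC M) C) :=
  [set sigma | am_out s sigma <> set0].

Definition am_AE (C : {set AG}) (s : ST) : set (set ST) :=
  [set am_out s sigma | sigma in @am_av C s].

End ActionModelTheory.

Definition is_cover (T : Type) (Delta : set (set T)) (X : set T) : Prop :=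
  \bigcup_(Y in Delta) Y = X /\ ~ Delta set0.

Definition odot (T : Type) (Delta1 Delta2 : set (set T)) : set (set T) :=
  [set Y | exists Y1 Y2, [/\ Delta1 Y1, Delta2 Y2, Y1 `&` Y2 <> set0
                           & Y = Y1 `&` Y2]].

Lemma odotC (T : Type) : commutative (@odot T).
Proof.
by move=> D E; apply/seteqP; split=> Y [Y1 [Y2 [? ? n0 ->]]];
  exists Y2, Y1; rewrite setIC; split=> //; rewrite setIC.
Qed.

Lemma odotA (T : Type) : associative (@odot T).
Proof.
have I0 (A B : set T) : A `&` B <> set0 -> A <> set0 /\ B <> set0.
  by move=> n0; split=> E; apply: n0; rewrite E ?set0I ?setI0.
move=> D E F; apply/seteqP; split=> Y.
- move=> [Y1 [_ [DY1 [Y2 [Y3 [EY2 FY3 _ ->]]] n0 ->]]].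
  exists (Y1 `&` Y2), Y3; move: n0; rewrite setIA => n0; split=> //.
  by exists Y1, Y2; split=> //; exact: (I0 _ _ n0).1.
- move=> [_ [Y3 [[Y1 [Y2 [DY1 EY2 _ ->]]] FY3 n0 ->]]].
  exists Y1, (Y2 `&` Y3); move: n0; rewrite -setIA => n0; split=> //.
  by exists Y2, Y3; split=> //; exact: (I0 _ _ n0).2.
Qed.

(* By [odotC] and [odotA] the order of the families is immaterial.  The value
   on the empty sequence is a dummy. *)
Definition bigodot (T : Type) (Deltas : seq (set (set T))) : set (set T) :=
  if Deltas is Delta :: Deltas' then foldl (@odot T) Delta Deltas' else set0.

Record neighborhood_model (AG : finType) (AP : countType) (ST : Type) :=
  NeighborhoodModel {
    nm_ST_nonempty : inhabited ST;
    nm_suc : ST -> set ST;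
    nm_nei1 : AG -> ST -> set (set ST);
    nm_L : ST -> set AP;
    nm_nei1_cover : forall (a : AG) (s : ST),
      is_cover (nm_nei1 a s) (nm_suc s) }.

(* The families [nei_a(s)], for [a] in [C], are combined as an indexed family:
   two agents of [C] with equal neighborhoods both contribute. *)
Definition nm_nei (AG : finType) (AP : countType) (ST : Type)
    (N : neighborhood_model AG AP ST) (C : {set AG}) (s : ST) :
    set (set ST) :=
  if `[< nm_suc N s = set0 >] then set0
  else if C == finset.set0 then [set nm_suc N s]
  else bigodot [seq nm_nei1 N a s | a <- enum C].

Definition z_representable (AG : finType) (AP : countType) (ST : Type)
    (M : action_model AG AP ST) (N : neighborhood_model AG AP ST) : Prop :=
  am_L M = nm_L N /\ forall C : {set AG}, am_AE M C = nm_nei N C.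

(* Main.v *)
Require Import Defs.
From mathcomp Require Import all_boot.
From mathcomp Require Import boolp classical_sets.

(** Let the actions be the sets of states: the action [Y] forces the outcome
    into [Y] when [Y] is a neighborhood of the agent at the current state, and
    has no outcome otherwise. A joint action of a coalition with a nonempty
    outcome then chooses one neighborhood for each member, and its outcome is
    their intersection, so the effective sets of the coalition are exactly the
    members of the combined neighborhood family. *)

Set Implicit Arguments.
Unset Strict Implicit.
Unset Printing Implicit Defensive.

Local Open Scope classical_set_scope.

Lemma bigodot_rcons (T : Type) (Ds : seq (set (set T))) (D : set (set T)) :
  Ds != [::] -> bigodot (rcons Ds D) = odot (bigodot Ds) D.
Proof. by case: Ds => //= E Ds _; rewrite foldl_rcons. Qed.

(* Without [uniq r], an index occurring twice could contribute two different
   members of its family. *)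
Lemma bigodotP (I : eqType) (T : Type) (F : I -> set (set T)) (r : seq I)
    (Y : set T) :
  (forall i, ~ F i set0) -> uniq r -> r != [::] ->
  bigodot [seq F i | i <- r] Y <->
  exists f : I -> set T, [/\ forall i, i \in r -> F i (f i),
    Y = \bigcap_(i in [set i | i \in r]) f i & Y <> set0].
Proof.
move=> F0; elim/last_ind: r Y => // r j IH Y.
rewrite rcons_uniq => /andP[jr ur] _.
(* The induction really starts at one index, as [bigodot] has a dummy value on the empty sequence. A
   single family passes through no [odot], so [Y <> set0] has to come from [F0] there. *)
case: (eqVneq r [::]) => [->|r0].
  split=> [/= FY|[f [Ff YE _]]].
    exists (fun=> Y); split=> [i||YE].
    - by rewrite inE => /eqP->.
    - apply/seteqP; split=> x; first by move=> Yx i _.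
      by apply; exact: mem_head.
    - by apply: (F0 j); rewrite -YE.
  suff -> : Y = f j by apply: Ff; exact: mem_head.
  rewrite YE; apply/seteqP; split=> x; first by apply; exact: mem_head.
  by move=> fx i /=; rewrite inE => /eqP->.
have map_neq0 : [seq F i | i <- r] != [::] by case: (r) r0.
rewrite map_rcons bigodot_rcons//; split.
- move=> [Y1 [Y2 [/(IH _ ur r0)[f [Ff -> _]] FY2 n0 ->]]].
  (* Since [j] is not in [r], giving [f] the new value [Y2] at [j] disturbs no earlier choice. *)
  have fE i : i \in r -> (if i == j then Y2 else f i) = f i.
    by case: eqVneq => // -> ij; rewrite ij in jr.
  exists (fun i => if i == j then Y2 else f i); split=> //.
    move=> i; rewrite mem_rcons inE; case: eqVneq => [->//|_ /= ir].
    exact: Ff.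
  apply/seteqP; split=> x.
    move=> [fx Y2x] i /=; rewrite mem_rcons inE.
    by case: eqVneq => //= _ ir; exact: fx.
  move=> h; split.
    by move=> i /= ir; rewrite -fE//; apply: h; rewrite /= mem_rcons inE ir orbT.
  by have := h j; rewrite /= mem_rcons mem_head eqxx; exact.
- move=> [f [Ff YE Y0]].
  have {}YE : Y = (\bigcap_(i in [set i | i \in r]) f i) `&` f j.
    rewrite YE; apply/seteqP; split=> x.
      move=> h; split; last by apply: h; rewrite /= mem_rcons mem_head.
      by move=> i /= ir; apply: h; rewrite /= mem_rcons inE ir orbT.
    by move=> [h fx] i /=; rewrite mem_rcons inE => /orP[/eqP->//|/h].
  exists (\bigcap_(i in [set i | i \in r]) f i), (f j); split=> //.
  + apply/(IH _ ur r0); exists f; split=> //.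
      by move=> i ir; apply: Ff; rewrite mem_rcons inE ir orbT.
    by move=> E; apply: Y0; rewrite YE E set0I.
  + by apply: Ff; rewrite mem_rcons mem_head.
  + by rewrite -YE.
Qed.

Section CanonicalActionModel.
Variables (AG : finType) (AP : countType) (ST : Type).
Variable N : neighborhood_model AG AP ST.

Definition nei_out1 (a : AG) (s : ST)
    (sigma : joint_action (set ST) [set a]%SET) : set ST :=
  [set x | nm_nei1 N a s (sigma (exist _ a (finset.set11 a))) /\
           sigma (exist _ a (finset.set11 a)) x].

(** Actions that are not neighborhoods contribute nothing, so the union is that of the
    neighborhoods, and these cover the successors. *)
Lemma nei_out1_suc (a : AG) (s : ST) :
  \bigcup_(sigma in [set: joint_action (set ST) [set a]%SET])
    nei_out1 s sigma = nm_suc N s.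
Proof.
have [<- _] := nm_nei1_cover N a s.
apply/seteqP; split=> [x [sigma _ [? ?]]|x [Y NY Yx]].
  by exists (sigma (exist _ a (finset.set11 a))).
by exists (fun=> Y).
Qed.

Definition nei_action_model : action_model AG AP ST :=
  @ActionModel AG AP ST (nm_ST_nonempty N) (set ST) (inhabits set0)
    (nm_suc N) nei_out1 (nm_L N) nei_out1_suc.

Lemma nei_out1_restrict1 (C : {set AG}) (s : ST) (a : {a : AG | a \in C})
    (sigma : joint_action (set ST) C) :
  nei_out1 s (restrict1 a sigma) =
  [set x | nm_nei1 N (sval a) s (sigma a) /\ sigma a x].
Proof.
rewrite /nei_out1 /restrict1 /restrict /=.
(* Restricting rebuilds the agent with another membership proof; boolean proofs are irrelevant. *)
set b := exist _ _ _; suff -> : b = a by [].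
by apply: val_inj.
Qed.

(** This puts the effective sets in the form of [bigodotP], with choice functions on all agents
    instead of on the subtype of members of [C]. *)
Lemma nei_action_modelAE (C : {set AG}) (s : ST) (Y : set ST) :
  C != finset.set0 ->
  am_AE nei_action_model C s Y <->
  exists f : AG -> set ST, [/\ forall a, a \in enum C -> nm_nei1 N a s (f a),
    Y = \bigcap_(a in [set a | a \in enum C]) f a & Y <> set0].
Proof.
move=> C0; rewrite /am_AE /am_av /am_out /= (negbTE C0); split.
- move=> [sigma /= n0 YE].
  (* The default [set0] is taken only outside [C], where [f] is never consulted. *)
  pose f a := if insub a is Some x then sigma x else set0.
  have fE a (aC : a \in C) : f a = sigma (exist _ a aC).
    by rewrite /f insubT.
  (* A single point of the outcome certifies that every member's action is a neighborhood, for
     otherwise that member's outcome would be empty. *)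
  have [y outy] : exists y, (\bigcap_(a in [set: {a | a \in C}])
      nei_out1 s (restrict1 a sigma)) y by apply/set0P/eqP.
  have nei_sigma (a : {a | a \in C}) : nm_nei1 N (sval a) s (sigma a).
    by have := outy a I; rewrite nei_out1_restrict1 => -[].
  exists f; split; last by rewrite -YE.
    move=> a; rewrite mem_enum => aC; rewrite (fE a aC).
    exact: (nei_sigma (exist _ a aC)).
  rewrite -YE; apply/seteqP; split=> x.
    move=> h a /=; rewrite mem_enum => aC; rewrite (fE a aC).
    by have := h (exist _ a aC) I; rewrite nei_out1_restrict1 => -[].
  move=> h [a aC] _; rewrite nei_out1_restrict1; split.
    exact: nei_sigma.
  by rewrite -fE; apply: h; rewrite /= mem_enum.
- move=> [f [Ff YE Y0]].
  have outE : \bigcap_(a in [set: {a | a \in C}])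
      nei_out1 s (restrict1 a (fun b => f (sval b))) = Y.
    rewrite YE; apply/seteqP; split=> x.
      move=> h a /=; rewrite mem_enum => aC.
      by have := h (exist _ a aC) I; rewrite nei_out1_restrict1 => -[].
    move=> h [a aC] _; rewrite nei_out1_restrict1 /=.
    by split; [apply: Ff; rewrite mem_enum|apply: h; rewrite /= mem_enum].
  by exists (fun b => f (sval b)) => //=; rewrite outE.
Qed.

Lemma nei_action_model_representable : z_representable nei_action_model N.
Proof.
split=> // C; apply/funext => s; rewrite /nm_nei.
case: (eqVneq C finset.set0) => [->|C0].
  rewrite /am_AE /am_av /am_out eqxx /=.
  case: asboolP => suc0; apply/seteqP; split=> Y //.
  - by move=> [].
  - by move=> [_ _ <-].
  (* Any witness works: the outcome of the empty coalition ignores the joint action. *)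
  - by move=> ->; exists (fun=> set0).
have enum0 : enum C != [::] by rewrite -size_eq0 -cardE cards_eq0.
case: asboolP => suc0.
  have [a aC] := set0Pn _ C0.
  apply/seteqP; split=> Y // /(nei_action_modelAE _ _ C0)[f [Ff YE Y0]].
  (* A point of [Y] would lie in the neighborhood [f a], hence in the empty successor set. *)
  have [x Yx] : exists x, Y x by apply/set0P/eqP.
  suff : (set0 : set ST) x by [].
  rewrite -suc0; have [<- _] := nm_nei1_cover N a s.
  have aE : a \in enum C by rewrite mem_enum.
  by exists (f a); [exact: Ff|move: Yx; rewrite YE; exact].
apply/seteqP; split=> Y.
  move/(nei_action_modelAE _ _ C0) => h; apply/bigodotP => //.
  - by move=> a; exact: (nm_nei1_cover N a s).2.
  - exact: enum_uniq.
move=> h; apply/(nei_action_modelAE _ _ C0).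
move: h; apply: (bigodotP _ _ _ _).1 => //.
- by move=> a; exact: (nm_nei1_cover N a s).2.
- exact: enum_uniq.
Qed.

End CanonicalActionModel.

Theorem theorem4p12 (AG : finType) (AG_nonempty : (0 < #|AG|)%N)
    (AP : countType) (ST : Type) (N : neighborhood_model AG AP ST) :
  exists M : action_model AG AP ST, z_representable M N.
Proof.
by exists (nei_action_model N); exact: nei_action_model_representable.
Qed.
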